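(* Let $\mathcal{F}$ be a Hilbert space, let $h:\mathbb{R}^p\to\mathcal{F}$ be differentiable with locally Lipschitz differential $Dh$, and let $R:\mathcal{F}\to\mathbb{R}_+$ be differentiable with Lipschitz gradient. Let $w_0\in\mathbb{R}^p$ and assume $h(w_0)=0$. For $\alpha>0$ let $w_\alpha$ and $\bar w_\alpha$ be the gradient flows, started from $w_0$, of the scaled objective $F_\alpha$ and of the scaled linearized objective $\bar F_\alpha$ respectively (as defined in the context). Then for every fixed time horizon $T>0$, as $\alpha\to\infty$, $$\sup_{t\in[0,T]}\|w_\alpha(t)-w_0\| = O(1/\alpha),\qquad \sup_{t\in[0,T]}\|w_\alpha(t)-\bar w_\alpha(t)\| = O(1/\alpha^2),$$ $$\sup_{t\in[0,T]}\|\alpha h(w_\alpha(t))-\alpha\bar h(\bar w_\alpha(t))\| = O(1/\alpha).$$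
   Context: $Dh(w):\mathbb{R}^p\to\mathcal{F}$ denotes the differential of $h$ at $w$, a continuous linear map, and $Dh(w)^\intercal$ its adjoint; (local) Lipschitz continuity of $w\mapsto Dh(w)$ is with respect to the operator norm. The linearized model at $w_0$ is $\bar h(w) := h(w_0)+Dh(w_0)(w-w_0)$. For $\alpha>0$, set $$F_\alpha(w):=\frac{1}{\alpha^2}R(\alpha h(w)),\qquad \bar F_\alpha(w):=\frac{1}{\alpha^2}R(\alpha\bar h(w)).$$ The gradient flow $(w_\alpha(t))_{t\ge 0}$ of $F_\alpha$ satisfies $w_\alpha(0)=w_0$ and $$w_\alpha'(t)=-\nabla F_\alpha(w_\alpha(t))=-\frac1\alpha Dh(w_\alpha(t))^\intercal\nabla R(\alpha h(w_\alpha(t))).$$ The gradient flow $(\bar w_\alpha(t))_{t\ge 0}$ of $\bar F_\alpha$ satisfies $\bar w_\alpha(0)=w_0$ and $$\bar w_\alpha'(t)=-\nabla\bar F_\alpha(\bar w_\alpha(t))=-\frac1\alpha Dh(w_0)^\intercal\nabla R(\alpha\bar h(\bar w_\alpha(t))).$$ The notation $O(\cdot)$ refers to $\alpha\to\infty$, with constants independent of $\alpha$ (but allowed to depend on $T,h,R,w_0$). *)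

(* Defs.v *)
From HB Require Import structures.
From mathcomp Require Import all_boot all_order all_algebra.
From mathcomp Require Import all_classical all_reals all_analysis.
Import Order.TTheory GRing.Theory Num.Theory.
Import numFieldNormedType.Exports.

Set Implicit Arguments.
Unset Strict Implicit.
Unset Printing Implicit Defensive.

Local Open Scope classical_set_scope.
Local Open Scope ring_scope.

(* Real Hilbert spaces: complete normed spaces whose norm comes from an inner
   product. *)
HB.mixin Record CompleteNormedModule_isHilbert (R : realType) V
    & CompleteNormedModule R V := {
  inner : {dot V for (@idfun R)} ;
  sqr_norm_inner : forall x : V, `|x| ^+ 2 = inner x x }.

#[short(type="hilbertType")]
HB.structure Definition Hilbert (R : realType) :=
  { V of CompleteNormedModule_isHilbert R V & CompleteNormedModule R V }.

(* The norm that MathComp-Analysis puts on 'rV[R]_p is the sup norm; it is used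
   here only through the topology (differentiability, limits) it induces, which
   is the Euclidean one. Gradients and norm estimates in R^p use the Euclidean
   structure below. *)
Definition dotrv (R : realType) (p : nat) (u v : 'rV[R]_p) : R :=
  \sum_(i < p) u 0 i * v 0 i.

Definition norm2 (R : realType) (p : nat) (u : 'rV[R]_p) : R :=
  Num.sqrt (dotrv u u).

(* The gradient of f at x: the vector representing the differential of f at x
   through the inner product dot. For f differentiable at x it exists, by the
   Riesz representation theorem, and is unique; 0 is a dummy default. *)
Definition grad (R : realType) (V : normedModType R) (dot : V -> V -> R)
    (f : V -> R) (x : V) : V :=
  xget 0 [set g | forall v, 'd f x v = dot g v].

(* The supremum of a set of reals that is not bounded above is 0; this does not
   occur for linear maps, which are bounded on the unit ball of R^p. *)
Definition opnorm (R : realType) (p : nat) (V : normedModType R)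
    (f : 'rV[R]_p -> V) : R :=
  sup [set `|f v| | v in [set v | norm2 v <= 1]].

Definition locally_lipschitz_diff (R : realType) (p : nat) (V : normedModType R)
    (h : 'rV[R]_p -> V) : Prop :=
  forall w : 'rV[R]_p, exists L : R, \forall u \near w & v \near w,
    opnorm (fun x => 'd h u x - 'd h v x) <= L * norm2 (u - v).

Definition linearized (R : realType) (p : nat) (V : normedModType R)
    (h : 'rV[R]_p -> V) (w0 w : 'rV[R]_p) : V :=
  h w0 + 'd h w0 (w - w0).

Definition scaled_objective (R : realType) (p : nat) (V : normedModType R)
    (obj : V -> R) (h : 'rV[R]_p -> V) (a : R) (w : 'rV[R]_p) : R :=
  (a ^+ 2)^-1 * obj (a *: h w).

(* The derivative at t is taken within the time domain [0, +oo[, so that it is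
   the right derivative at t = 0; values at negative times are irrelevant. *)
Definition gradient_flow (R : realType) (p : nat) (f : 'rV[R]_p -> R)
    (w0 : 'rV[R]_p) (w : R -> 'rV[R]_p) : Prop :=
  w 0 = w0 /\
  forall t : R, 0 <= t ->
    (s - t)^-1 *: (w s - w t) @[s --> within `[0, +oo[ t^']
      --> - grad (@dotrv R p) f (w t).

(* Used only for functions that are continuous on [0, T], hence bounded there. *)
Definition sup_on (R : realType) (T : R) (f : R -> R) : R :=
  sup [set f t | t in `[0, T]].

(* Allows +oo as the filter of the notation f =O_F g. *)
Canonical pinfty_filter_on (R : numFieldType) : filter_on R :=
  FilterType (pinfty_nbhs R) _.

(* Main.v *)
Require Import Defs.
From mathcomp Require Import all_boot all_order all_algebra.
From mathcomp Require Import all_classical all_reals all_analysis.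
From mathcomp Require Import ring lra.
Import Order.TTheory GRing.Theory Num.Theory.
Import numFieldNormedType.Exports.
Local Open Scope classical_set_scope.
Local Open Scope ring_scope.

Set Implicit Arguments.
Unset Strict Implicit.
Unset Printing Implicit Defensive.

(** Why a large scale a freezes the dynamics around the linearized model.

    Displacement. Along a gradient flow of a nonnegative function f, the square
    integral of the velocity is at most f w0, hence the displacement at time t
    is at most the square root of t * f w0 (gradient_flow_dist). For the scaled
    objective, h w0 = 0 gives f w0 = obj 0 / a ^+ 2, and the displacement on
    [0, T] is at most C / a with C independent of a. In particular, for large a
    the flow stays in the ball around w0 on which the differential of h is
    Lipschitz.

    Comparison. Let u and v be the positions of the two flows at a given time
    and n their distance. By Taylor's formula the outputs a *: h u and
    a *: linearized h w0 v differ by O(1 / a) + O(a * n) (model_gap_le), and the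
    gradient of obj is bounded at a *: h u since that output is bounded
    (norm_grad_le). As the gradients of the scaled objectives carry a factor
    1 / a, and as the differentials of h at u and at w0 differ by O(1 / a), the
    two gradient fields differ by O(1 / a ^+ 2) + O(n) (flow_gap_rate_le).
    Gronwall's inequality (gradient_flow_gronwall) then gives n = O(1 / a ^+ 2)
    on [0, T]. Inserting this into the bound on the outputs gives their distance
    O(1 / a).

    The gradients of the scaled objectives enter only through their inner
    product with u - v, that is, through differentials, so adjoints never have
    to be formed. The one place where the gradient of obj itself is needed is
    its Lipschitz bound: that it represents the differential of obj is the Riesz
    representation theorem (riesz_representation). *)

(** * Real Hilbert spaces and the Riesz representation theorem *)

Section hilbert.
Context {R : realType} {F : hilbertType R}.
Implicit Types (x y z : F) (a : R).

Lemma innerC x y : inner x y = inner y x.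
Proof. by rewrite (hermC (@inner R F)) expr0 mul1r. Qed.

Lemma innerZr a x y : inner x (a *: y) = a * inner x y.
Proof. by rewrite linearZ. Qed.

Lemma innerZl a x y : inner (a *: x) y = a * inner x y.
Proof. by rewrite innerC innerZr innerC. Qed.

Lemma sqr_normD x y : `|x + y| ^+ 2 = `|x| ^+ 2 + 2 * inner x y + `|y| ^+ 2.
Proof. by rewrite !sqr_norm_inner linearDr !linearDl /= (innerC y x); ring. Qed.

(** Cauchy-Schwarz inequality: expand the square of
    `|y| *: x - `|x| *: y. *)
Lemma inner_le x y : inner x y <= `|x| * `|y|.
Proof.
have [->|x0] := eqVneq x 0; first by rewrite linear0l normr0 mul0r.
have [->|y0] := eqVneq y 0; first by rewrite linear0r normr0 mulr0.
have xy0 : 0 < `|x| * `|y| by rewrite mulr_gt0 ?normr_gt0.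
have := sqr_ge0 (`| `|y| *: x + (- `|x|) *: y|).
rewrite sqr_normD innerZl innerZr !normrZ normrN !normr_id => h.
by rewrite -(ler_pM2l xy0); nra.
Qed.

Lemma ler_abs_inner x y : `|inner x y| <= `|x| * `|y|.
Proof.
rewrite ler_norml inner_le andbT lerNl -linearNl.
by rewrite (le_trans (inner_le _ _))// normrN.
Qed.

Lemma inner_continuous z : continuous (inner z).
Proof.
apply/linear_bounded_continuous/linear_boundedP; near=> r => x.
rewrite (le_trans (ler_abs_inner _ _))// ler_wpM2r//.
Unshelve. all: by end_near. Qed.

(** The representing vector is the minimizer of the strictly convex functional
    J x = `|x| ^+ 2 - 2 * l x, whose stationarity condition at g is
    l x = inner g x for all x. Completeness gives the minimizer. *)
Lemma riesz_representation (l : {linear F -> R}) :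
  continuous l -> exists g, forall x, l x = inner g x.
Proof.
move=> lc; have [k k0 lk] := linear_lipschitz lc.
have lZ a x : l (a *: x) = a * l x by rewrite linearZ.
have lD x y : l (x + y) = l x + l y by rewrite linearD.
pose J x : R := `|x| ^+ 2 - 2 * l x.
have J_ge x : - k ^+ 2 <= J x.
  have := lk x; rewrite /J => /ler_normlW.
  by have := sqr_ge0 (`|x| - k); nra.
have J_inf : has_inf (range J).
  by split; [exists (J 0); exists 0|exists (- k ^+ 2) => _ [x _ <-]].
pose m := inf (range J).
have m_le x : m <= J x by apply: ge_inf; [exact: J_inf.2|exists x].
have /choice[x Jx] : forall n : nat, exists x, J x < m + n.+1%:R^-1.
  move=> n; have n0 : 0 < n.+1%:R^-1 :> R by rewrite invr_gt0.
  by have [_ [x _ <-] ?] := inf_adherent n0 J_inf; exists x.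
(* The parallelogram identity makes J uniformly convex, so that minimizing
   sequences are Cauchy. *)
have parallelogram u v :
    `|u - v| ^+ 2 = 2 * J u + 2 * J v - 4 * J (2^-1 *: (u + v)).
  rewrite /J lZ lD normrZ exprMn sqr_normD.
  by rewrite ger0_norm ?invr_ge0// sqr_normD normrN linearNr; field.
have x_cauchy : cauchy (x @ \oo).
  apply: cauchy_exP => e e0.
  have e2 : 0 < e ^+ 2 / 4 by rewrite divr_gt0 ?exprn_gt0.
  have [N _ HN] := near_infty_natSinv_lt (PosNum e2).
  exists (x N); exists N => // n /= Nn.
  rewrite -ball_normE /= -(ltr_pXn2r (n:=2)) ?nnegrE ?(ltW e0)//.
  rewrite parallelogram; have := HN N (leqnn N); have := HN n Nn => /=.
  have := Jx n; have := Jx N; have := m_le (2^-1 *: (x N + x n)).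
  by move: n.+1%:R^-1 N.+1%:R^-1 => i j /=; lra.
have /cauchy_cvgP/cvg_ex[/= g xg] := x_cauchy.
have Jg : J g <= m.
  have Jxg : J (x n) @[n --> \oo] --> J g.
    apply: cvgB.
      rewrite expr2; under eq_fun do rewrite expr2.
      by apply: cvgM; exact: cvg_norm.
    by apply: cvgMr; apply: continuous_cvg xg; exact: lc.
  have mx : m + n.+1%:R^-1 @[n --> \oo] --> m + 0.
    by apply: cvgD; [exact: cvg_cst|exact: cvg_harmonic].
  rewrite -[m]addr0; apply: ler_cvg_to Jxg mx _.
  by near=> n; exact/ltW/Jx.
exists g => v.
have quad t : 0 <= 2 * t * (inner g v - l v) + t ^+ 2 * `|v| ^+ 2.
  have := m_le (g + t *: v); move: Jg; rewrite /J sqr_normD lD lZ.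
  rewrite innerZr normrZ exprMn real_normK ?num_real//; lra.
set b := inner g v - l v in quad *.
(* The quadratic inequality at t := - b * c forces b = 0. The minimum over t
   would be at - b / `|v| ^+ 2; the added 1 avoids a division by 0. *)
pose c : R := (1 + `|v| ^+ 2)^-1.
have c0 : 0 < c by rewrite invr_gt0 ltr_pwDl// exprn_ge0.
have cv : c * `|v| ^+ 2 <= 1.
  by rewrite mulrC ler_pdivrMr ?mul1r ?lerDr// ltr_pwDl// exprn_ge0.
have : c * b ^+ 2 <= 0.
  have /ler_wpM2l/(_ _ _ cv) : 0 <= c * b ^+ 2.
    by rewrite mulr_ge0 ?sqr_ge0// ltW.
  have := quad (- b * c); lra.
rewrite pmulr_rle0// => b2.
by apply/eqP; rewrite eq_sym -subr_eq0 -/b -sqrf_eq0 eq_le b2 sqr_ge0.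
Unshelve. all: by end_near. Qed.
End hilbert.

(** * Gradients, the Euclidean norm and the operator norm *)

Section gradients.
Context {R : realType}.

Lemma gradP (V : normedModType R) (dot : V -> V -> R) (f : V -> R) (x : V) :
  (exists g, forall v, 'd f x v = dot g v) ->
  forall v, 'd f x v = dot (grad dot f x) v.
Proof. by move=> gP; exact: (xgetPex 0 gP). Qed.

Lemma grad_innerP (F : hilbertType R) (f : F -> R) (x v : F) :
  differentiable f x -> 'd f x v = inner (grad (@inner R F) f x) v.
Proof.
by move=> df; apply: gradP; apply: riesz_representation; exact: diff_continuous.
Qed.

Context {p : nat}.
Implicit Types (u v : 'rV[R]_p) (a : R).

Lemma grad_dotrvP (f : 'rV[R]_p -> R) u v :
  'd f u v = dotrv (grad (@dotrv R p) f u) v.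
Proof.
apply: gradP; exists (\row_i 'd f u (delta_mx 0 i)) => {}v.
rewrite [in LHS](row_sum_delta v) linear_sum; apply: eq_bigr => i _.
by rewrite linearZ /= mxE mulrC.
Qed.

Lemma dotrvC u v : dotrv u v = dotrv v u.
Proof. by apply: eq_bigr => i _; rewrite mulrC. Qed.

Lemma dotrvDr u v v' : dotrv u (v + v') = dotrv u v + dotrv u v'.
Proof. by rewrite -big_split; apply: eq_bigr => i _; rewrite mxE mulrDr. Qed.

Lemma dotrvZr a u v : dotrv u (a *: v) = a * dotrv u v.
Proof.
by rewrite /dotrv mulr_sumr; apply: eq_bigr => i _; rewrite mxE mulrCA.
Qed.

Lemma dotrvNr u v : dotrv u (- v) = - dotrv u v.
Proof. by rewrite -scaleN1r dotrvZr mulN1r. Qed.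

Lemma dotrv0r u : dotrv u 0 = 0.
Proof. by rewrite -(scale0r 0) dotrvZr mul0r. Qed.

Lemma dotrv_ge0 u : 0 <= dotrv u u.
Proof. by apply: sumr_ge0 => i _; rewrite -expr2 sqr_ge0. Qed.

Lemma norm2_ge0 u : 0 <= norm2 u. Proof. exact: sqrtr_ge0. Qed.

Lemma sqr_norm2 u : norm2 u ^+ 2 = dotrv u u.
Proof. by rewrite sqr_sqrtr ?dotrv_ge0. Qed.

Lemma norm2_0 : norm2 (0 : 'rV[R]_p) = 0.
Proof. by rewrite /norm2 dotrv0r sqrtr0. Qed.

Lemma norm2Z a u : norm2 (a *: u) = `|a| * norm2 u.
Proof.
rewrite /norm2 dotrvZr dotrvC dotrvZr mulrA -expr2.
by rewrite sqrtrM ?sqr_ge0// sqrtr_sqr.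
Qed.

Lemma mx_norm_le_norm2 u : `|u| <= norm2 u.
Proof.
rewrite /Num.Def.normr /= mx_normrE; apply: bigmax_le => [|[i j] _ /=].
  exact: norm2_ge0.
rewrite ord1 -sqrtr_sqr ler_sqrt ?dotrv_ge0// /dotrv (bigD1 j)//= -expr2 lerDl.
by apply: sumr_ge0 => k _; rewrite -expr2 sqr_ge0.
Qed.

Lemma linear_norm2_lipschitz (V : normedModType R)
    (f : {linear 'rV[R]_p -> V}) :
  continuous f -> exists2 k, 0 < k & forall u, `|f u| <= k * norm2 u.
Proof.
move=> /linear_lipschitz[k k0 fk]; exists k => // u.
by rewrite (le_trans (fk u))// ler_pM2l// mx_norm_le_norm2.
Qed.

(** The supremum defining opnorm f is a genuine one only if f is bounded on the
    unit ball; the constant k witnesses this and disappears from the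
    conclusion. *)
Lemma ler_opnorm (V : normedModType R) (f : 'rV[R]_p -> V) (k : R) :
  scalable f -> (forall u, `|f u| <= k * norm2 u) ->
  forall u, `|f u| <= opnorm f * norm2 u.
Proof.
move=> fZ fk u.
have [u0|u0] := eqVneq (norm2 u) 0; first by have := fk u; rewrite u0 !mulr0.
have ugt0 : 0 < norm2 u by rewrite lt0r u0 norm2_ge0.
rewrite -ler_pdivrMr//; apply: ub_le_sup.
  exists `|k| => _ [v /= v1 <-]; rewrite (le_trans (fk v))//.
  rewrite (le_trans (ler_norm _))// normrM (ger0_norm (norm2_ge0 _)).
  by rewrite ler_piMr.
exists ((norm2 u)^-1 *: u).
  by rewrite /= norm2Z normfV ger0_norm ?norm2_ge0// mulVf.
by rewrite fZ normrZ normfV (ger0_norm (norm2_ge0 _)) mulrC.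
Qed.

(** Continuity provides the bound on the unit ball that ler_opnorm asks for. *)
Lemma ler_opnormB (V : normedModType R) (f g : {linear 'rV[R]_p -> V}) :
  continuous f -> continuous g ->
  forall u, `|f u - g u| <= opnorm (fun x => f x - g x) * norm2 u.
Proof.
move=> /linear_norm2_lipschitz[k _ fk] /linear_norm2_lipschitz[k' _ gk] u.
apply: (@ler_opnorm _ (fun x => f x - g x) (k + k')) => [a|v].
  by move=> v; rewrite scalerBr; congr (_ - _); exact: linearZZ.
by rewrite (le_trans (ler_normB _ _))// mulrDl lerD.
Qed.

End gradients.

(** * Differential inequalities along curves *)

Section curves.
Context {R : realType}.

Lemma is_derive_comp_diff (V W : normedModType R) (c : R -> V) (f : V -> W)
    (t : R) (dc : V) :
  is_derive t 1 c dc -> differentiable f (c t) ->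
  is_derive t 1 (fun s => f (c s)) ('d f (c t) dc).
Proof.
move=> [/derivable1_diffP cd cE] fd.
have fcd : differentiable (f \o c) t by exact: differentiable_comp.
apply: DeriveDef; first exact/derivable1_diffP.
by rewrite deriveE// diff_comp//= -(deriveE _ cd) cE.
Qed.

Lemma is_derive_dotrv (p : nat) (x y : R -> 'rV[R]_p) (t : R)
    (dx dy : 'rV[R]_p) :
  is_derive t 1 x dx -> is_derive t 1 y dy ->
  is_derive t 1 (fun s => dotrv (x s) (y s)) (dotrv dx (y t) + dotrv (x t) dy).
Proof.
have coord (z : R -> 'rV[R]_p) dz i : is_derive t 1 z dz ->
    is_derive t 1 (fun s : R => z s 0 i : R) (dz 0 i : R).
  move=> [zd zE]; apply: DeriveDef; first by move/derivable_mxP : zd; apply.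
  by rewrite -zE derive_mx// mxE.
move=> xd yd.
have -> : (fun s => dotrv (x s) (y s)) =
    \sum_(i < p) ((fun s => x s 0 i) * (fun s => y s 0 i)).
  by apply/funext => s; rewrite fct_sumE.
rewrite -big_split/=; apply: is_derive_sum => i.
have cx := coord x dx i xd; have cy := coord y dy i yd.
apply: is_derive_eq.
by rewrite addrC /GRing.scale /= (mulrC (y t 0 i)).
Qed.

Lemma cvg_dotrv (p : nat) (T : Type) (G : set_system T) {FG : Filter G}
    (x y : T -> 'rV[R]_p) (a b : 'rV[R]_p) :
  x s @[s --> G] --> a -> y s @[s --> G] --> b ->
  dotrv (x s) (y s) @[s --> G] --> dotrv a b.
Proof.
move=> xa yb; apply: cvg_big => [|i _]; first exact: add_continuous.
apply: cvgM.
  exact: (cvg_comp _ _ xa (@coord_continuous R _ _ 0 i a)).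
exact: (cvg_comp _ _ yb (@coord_continuous R _ _ 0 i b)).
Qed.

(** Differentiability is required only away from 0, with right continuity
    there, because a gradient flow has just a one-sided derivative at time 0. *)
Lemma le0_derive_le (g dg : R -> R) (T : R) : 0 <= T ->
  (forall t, 0 < t <= T -> is_derive t 1 g (dg t)) ->
  (forall t, 0 < t <= T -> dg t <= 0) ->
  g t @[t --> 0^'+] --> g 0 -> g T <= g 0.
Proof.
rewrite le_eqVlt => /predU1P[<-//|T0] gd dg0 g0.
have Ioc t : t \in `]0, T[ -> 0 < t <= T.
  by rewrite in_itv /= => /andP[-> /ltW ->].
have gc t : 0 < t <= T -> g s @[s --> t] --> g t.
  by move=> /gd[/derivable1_diffP ? _]; exact: differentiable_continuous.
apply: (@ler0_derive1_le_cc _ g 0 T).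
- by move=> t /Ioc/gd[].
- by move=> t /Ioc tI; rewrite derive1E; have [_ ->] := gd _ tI; exact: dg0.
- apply/continuous_within_itvP => //; split => //.
    by move=> t /Ioc; exact: gc.
  by apply: cvg_at_left_filter; apply: gc; rewrite T0 /=.
- by rewrite in_itv /= lexx ltW.
- by rewrite in_itv /= lexx ltW.
- exact: ltW.
Qed.

(** The function g t * expR (- B * t) - A * t is nonincreasing, since its
    derivative is at most A * expR (- B * t) - A. *)
Lemma gronwall (g dg : R -> R) (A B T : R) : 0 <= A -> 0 <= B -> 0 <= T ->
  (forall t, 0 < t <= T -> is_derive t 1 g (dg t)) ->
  (forall t, 0 < t <= T -> dg t <= A + B * g t) ->
  g t @[t --> 0^'+] --> g 0 -> g T <= (g 0 + A * T) * expR (B * T).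
Proof.
move=> A0 B0 T0 gd dgle g0.
pose e (t : R) : R := expR (- B * t).
have eT (t : R) : e t * expR (B * t) = 1.
  by rewrite /e mulNr mulrC expRxMexpNx_1.
have e_gt0 (t : R) : 0 < e t by exact: expR_gt0.
have ed (t : R) : is_derive t 1 e (e t * - B).
  have Bd : is_derive t 1 ( *%R (- B) : R -> R) (- B).
    by apply: is_derive_eq; rewrite /GRing.scale /= mulr1.
  have expd := is_derive_expR (- B * t).
  have [/derivable1_diffP expD _] := expd.
  apply: is_derive_eq (is_derive_comp_diff Bd expD) _.
  rewrite diff1E// derive1E (@derive_val _ _ _ _ _ _ _ expd).
  by rewrite /GRing.scale /= mulrC.
pose G (t : R) : R := g t * e t - A * t.
suff : G T <= G 0.
  rewrite /G mulr0 subr0 {2}/e mulr0 expR0 mulr1 lerBlDr => GT.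
  by rewrite -[leLHS]mulr1 -(eT T) mulrA ler_pM2r ?expR_gt0.
apply: (@le0_derive_le G (fun t => (dg t * e t + g t * (e t * - B)) - A)) => //.
- move=> t tI; have ? := gd t tI; have ? := ed t.
  by apply: is_derive_eq; rewrite /GRing.scale /= mulr1; ring.
- move=> t tI.
  have et1 : e t <= 1.
    rewrite -expR0 ler_expR mulNr oppr_le0 mulr_ge0//.
    by case/andP: tI => /ltW.
  have := dgle t tI => H.
  have := ler_wpM2r (ltW (e_gt0 t)) H.
  have := ler_wpM2l A0 et1; nra.
- apply: cvgB.
    apply: cvgM => //; apply: cvg_at_right_filter.
    have [/derivable1_diffP ? _] := ed 0.
    exact: differentiable_continuous.
  apply: cvg_at_right_filter; apply: cvgM; [exact: cvg_cst|exact: cvg_id].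
Qed.

Context {p : nat}.
Implicit Types (f : 'rV[R]_p -> R) (w : R -> 'rV[R]_p) (t : R).

Lemma gradient_flow_is_derive f (w0 : 'rV[R]_p) w t :
  gradient_flow f w0 w -> 0 < t ->
  is_derive t 1 w (- grad (@dotrv R p) f (w t)).
Proof.
move=> [_ /(_ t)] wd t0; have /cvgrPdist_lt {}wd := wd (ltW t0).
set l := - grad _ _ _ in wd *.
have q : h^-1 *: (w (h *: 1 + t) - w t) @[h --> 0^'] --> l.
  apply/cvgrPdist_lt => e /wd; rewrite !near_withinE => -[d /= d0 dP].
  exists (Num.min d t) => /=; first by rewrite lt_min d0.
  move=> h; rewrite /= sub0r normrN lt_min => /andP[hd ht] h0.
  have -> : h^-1 = (h *: 1 + t - t)^-1 by rewrite addrK [h *: 1]mulr1.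
  rewrite [h *: 1]mulr1; apply: dP.
  - by rewrite /= opprD addrCA subrr addr0 normrN.
  - by rewrite -subr_eq0 addrK.
  - by rewrite /= in_itv /= andbT; move: ht; rewrite ltr_norml; lra.
apply: DeriveDef; first by apply/cvg_ex; exists l.
exact/cvg_lim.
Qed.

Lemma gradient_flow_cvg0 f (w0 : 'rV[R]_p) w : gradient_flow f w0 w ->
  w t @[t --> 0^'+] --> w 0.
Proof.
move=> [_ /(_ 0 (lexx _))]; set l := - grad _ _ _ => wd.
have q : (t - 0)^-1 *: (w t - w 0) @[t --> 0^'+] --> l.
  apply: cvg_trans wd; apply: cvg_app => A [d /= d0 dP].
  exists d => //= t td t0; apply: dP => //; first by rewrite gt_eqF.
  by rewrite /= in_itv /= (ltW t0).
have sq : t *: ((t - 0)^-1 *: (w t - w 0)) + w 0 @[t --> 0^'+]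
    --> 0 *: l + w 0.
  apply: cvgD; last exact: cvg_cst.
  by apply: cvgZ q; apply: cvg_at_right_filter; exact: cvg_id.
rewrite scale0r add0r in sq.
apply: cvg_trans sq; apply: near_eq_cvg; near=> t.
by rewrite subr0 scalerA divff ?scale1r ?subrK// gt_eqF.
Unshelve. all: by end_near. Qed.

End curves.

(** * Gradient flows in Euclidean space *)

Section flows.
Context {R : realType} {p : nat}.
Implicit Types (f : 'rV[R]_p -> R) (T : R).

(** Energy dissipation. The velocity of the flow has square integral
    f w0 - f (w T) <= f w0 over [0, T], and by the Cauchy-Schwarz inequality in
    time the squared displacement is at most T times that integral. The proof
    needs no integral: with e the displacement at time T and G the gradient
    along the flow, the derivative of the function g below is minus the squared
    norm of T *: G t + e, and g T <= g 0 is the claim. *)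
Lemma gradient_flow_dist f (w0 : 'rV[R]_p) w T :
  (forall u, differentiable f u) -> (forall u, 0 <= f u) ->
  gradient_flow f w0 w -> 0 <= T -> norm2 (w T - w0) ^+ 2 <= T * f w0.
Proof.
move=> fd f0 wf; rewrite le_eqVlt => /predU1P[<-|T0].
  by rewrite wf.1 subrr norm2_0 expr0n mul0r.
rewrite sqr_norm2; set e := w T - w0.
have eE : dotrv e e = dotrv e (w T) - dotrv e w0.
  by rewrite {2}/e dotrvDr dotrvNr.
clearbody e.
pose g t := 2 * T * dotrv e (w t) + T ^+ 2 * f (w t) - dotrv e e * t.
pose G t := grad (@dotrv R p) f (w t).
have gT : g T <= g 0.
  apply: (@le0_derive_le _ g (fun t => - dotrv (T *: G t + e) (T *: G t + e))).
  - exact: ltW.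
  - move=> t /andP[t0 _].
    have wd := gradient_flow_is_derive wf t0; rewrite -/(G t) in wd.
    have ed := is_derive_dotrv (is_derive_cst e t 1) wd.
    have fwd := is_derive_comp_diff wd (fd (w t)).
    apply: is_derive_eq (is_deriveB (is_deriveD (is_deriveZ (2 * T) ed)
      (is_deriveZ (T ^+ 2) fwd))
      (is_deriveZ (dotrv e e) (is_derive_id t (1 : R)))) _.
    rewrite /= grad_dotrvP -/(G t) [dotrv 0 _]dotrvC dotrv0r !dotrvNr dotrvDr.
    rewrite dotrvZr.
    rewrite !(dotrvC _ (G t)) !(dotrvC _ e) !dotrvDr !dotrvZr (dotrvC e (G t)).
    by rewrite /GRing.scale /=; ring.
  - by move=> t _; rewrite oppr_le0 dotrv_ge0.
  - apply: cvgB.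
      apply: cvgD; apply: cvgMr.
        by apply: cvg_dotrv; [exact: cvg_cst|exact: gradient_flow_cvg0 wf].
      apply: (cvg_comp _ _ (gradient_flow_cvg0 wf)).
      exact: (differentiable_continuous (fd (w 0))).
    by apply: cvgMr; apply: cvg_at_right_filter; exact: cvg_id.
rewrite -(ler_pM2l T0); move: gT; rewrite /g wf.1 eE.
by have := mulr_ge0 (sqr_ge0 T) (f0 (w T)); lra.
Qed.

(** The squared distance between two flows satisfies a Gronwall inequality. Its
    derivative is written with the differentials of f1 and f2 in the direction
    w1 t - w2 t, which spares the adjoints of the differentials of the models
    later on. *)
Lemma gradient_flow_gronwall f1 f2 (w0 : 'rV[R]_p) w1 w2 A B T :
  gradient_flow f1 w0 w1 -> gradient_flow f2 w0 w2 ->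
  0 <= A -> 0 <= B -> 0 <= T ->
  (forall t, 0 < t <= T ->
    2 * ('d f2 (w2 t) (w1 t - w2 t) - 'd f1 (w1 t) (w1 t - w2 t)) <=
      A + B * norm2 (w1 t - w2 t) ^+ 2) ->
  norm2 (w1 T - w2 T) ^+ 2 <= A * T * expR (B * T).
Proof.
move=> wf1 wf2 A0 B0 T0 dle; rewrite sqr_norm2.
have sym (u v x : 'rV[R]_p) : dotrv (- u - - v) x + dotrv x (- u - - v) =
    2 * (dotrv v x - dotrv u x).
  by rewrite (dotrvC _ x) dotrvDr !dotrvNr (dotrvC u x) (dotrvC v x); ring.
pose d t := w1 t - w2 t.
pose g t := dotrv (d t) (d t).
have d0 : d 0 = 0 by rewrite /d wf1.1 wf2.1 subrr.
have g0 : g 0 = 0 by rewrite /g d0 -sqr_norm2 norm2_0 expr0n.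
rewrite -/(d T) -/(g T) -[A * T]add0r -g0.
apply: (@gronwall _ g
  (fun t => 2 * ('d f2 (w2 t) (d t) - 'd f1 (w1 t) (d t)))) => //.
- move=> t /andP[t0 _].
  have w1d := gradient_flow_is_derive wf1 t0.
  have w2d := gradient_flow_is_derive wf2 t0.
  have dd : is_derive t 1 d _ := is_deriveB w1d w2d.
  apply: is_derive_eq (is_derive_dotrv dd dd) _.
  by rewrite sym; congr (_ * (_ - _)); apply: esym; exact: grad_dotrvP.
- by move=> t /dle; rewrite sqr_norm2.
- have dc : d t @[t --> 0^'+] --> d 0.
    exact: cvgB (gradient_flow_cvg0 wf1) (gradient_flow_cvg0 wf2).
  exact: (cvg_dotrv dc dc).
Qed.

End flows.

(** * The model, its linearization and the scaled objectives *)

Section model.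
Context {R : realType} {p : nat} {F : hilbertType R}.
Implicit Types (h : 'rV[R]_p -> F) (obj : F -> R) (u v : 'rV[R]_p).
Implicit Types (a r s : R).

Lemma differentiable_scaled_objective obj h a u :
  (forall x, differentiable obj x) -> differentiable h u ->
  differentiable (scaled_objective obj h a) u.
Proof.
move=> objd hd; apply: differentiableM; first exact: differentiable_cst.
by apply: differentiable_comp; [exact: differentiableZ|exact: objd].
Qed.

(** Chain rule. The factor a of the scaled model cancels one of the two factors
    a^-1 of the objective: gradients of the scaled objective have size 1 / a. *)
Lemma diff_scaled_objective obj h a u v : a != 0 ->
  (forall x, differentiable obj x) -> differentiable h u ->
  'd (scaled_objective obj h a) u v =
  a^-1 * inner (grad (@inner R F) obj (a *: h u)) ('d h u v).
Proof.
move=> a0 objd hd.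
have ahd : differentiable (a \*: h) u by exact: differentiableZ.
have cd : differentiable (obj \o (a \*: h)) u.
  by apply: differentiable_comp; [exact: ahd|exact: objd].
have -> : scaled_objective obj h a = (a ^+ 2)^-1 *: (obj \o (a \*: h)).
  by apply/funext.
rewrite diffZ//= diff_comp//= diffZ//= grad_innerP// innerZr.
by rewrite /GRing.scale /= expr2 invfM -mulrA mulKf.
Qed.

Lemma is_diff_linearized h (w0 u : 'rV[R]_p) : differentiable h w0 ->
  is_diff u (linearized h w0) ('d h w0).
Proof.
move=> hd; have hc : continuous ('d h w0) by exact: diff_continuous.
have -> : linearized h w0 = ('d h w0 : 'rV[R]_p -> F) + cst (h w0 - 'd h w0 w0).
  by apply/funext => x; rewrite /linearized linearB /= addrC [RHS]addrA addrAC.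
have dl : is_diff u ('d h w0) ('d h w0).
  by apply: DiffDef; [exact: linear_differentiable|exact: diff_lin].
by apply: is_diff_eq; rewrite addr0.
Qed.

(** The local Lipschitz condition is made quantitative on a ball, with w0 as
    reference point: for large scales, the displacement bound keeps the flow in
    that ball. *)
Lemma locally_lipschitz_diff_center h (w0 : 'rV[R]_p) :
  (forall u, differentiable h u) -> locally_lipschitz_diff h ->
  exists2 r, 0 < r & exists2 L, 0 <= L & forall u, norm2 (u - w0) < r ->
    forall v, `|'d h u v - 'd h w0 v| <= L * norm2 (u - w0) * norm2 v.
Proof.
move=> hd /(_ w0)[L [[A B] /= [nA nB] AB]].
have /nbhs_ballP[r /= r0 rP] : nbhs w0 A by [].
exists r => //; exists `|L| => // u ur v.
have uc := diff_continuous (hd u); have w0c := diff_continuous (hd w0).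
apply: le_trans (ler_opnormB uc w0c v) _.
rewrite ler_wpM2r ?norm2_ge0//.
have uL := AB (u, w0) (conj _ (nbhs_singleton nB)).
rewrite (le_trans (uL _))//.
  by apply: rP; rewrite -ball_normE/= distrC (le_lt_trans (mx_norm_le_norm2 _)).
by rewrite ler_wpM2r ?norm2_ge0// ler_norm.
Qed.

(** With z the remainder, the mean value inequality is applied to the scalar
    function inner z (h (c s)) along the segment c from w0 to u; this yields
    `|z| ^+ 2 <= `|z| * (L * norm2 (u - w0) ^+ 2). *)
Lemma taylor1_le h (w0 : 'rV[R]_p) r (L : R) :
  (forall u, differentiable h u) -> 0 <= L ->
  (forall u, norm2 (u - w0) < r ->
    forall v, `|'d h u v - 'd h w0 v| <= L * norm2 (u - w0) * norm2 v) ->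
  forall u, norm2 (u - w0) < r ->
    `|h u - h w0 - 'd h w0 (u - w0)| <= L * norm2 (u - w0) ^+ 2.
Proof.
move=> hd L0 hL u ur; set z := _ - _; pose e := u - w0.
pose c s := w0 + s *: e.
pose k := inner z ('d h w0 e) + `|z| * (L * norm2 e ^+ 2).
pose g s : R := inner z (h (c s)) - k * s.
have g10 : g 1 <= g 0.
  have gd s : is_derive s 1 g (inner z ('d h (c s) e) - k).
    have cd : is_derive s 1 c e.
      have c_diff : is_diff s c ( *:%R^~ e).
        apply: is_diff_eq (is_diffD (is_diff_cst w0 s) (is_diff_scalel s e)) _.
        exact: add0r.
      apply: DeriveDef; first exact/derivable1_diffP.
      by rewrite deriveE// diff_val scale1r.
    have zd x : differentiable (inner z) x.
      by apply: linear_differentiable; exact: inner_continuous.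
    have hcd := is_derive_comp_diff (is_derive_comp_diff cd (hd _)) (zd _).
    apply: is_derive_eq
      (is_deriveB hcd (is_deriveZ _ (is_derive_id s (1 : R)))) _.
    rewrite diff_lin; last exact: inner_continuous.
    by rewrite /GRing.scale/= mulr1.
  apply: (@le0_derive_le _ g (fun s => inner z ('d h (c s) e) - k)) => //.
    move=> t /andP[t0 t1]; rewrite opprD addrA -linearBr subr_le0.
    rewrite (le_trans (inner_le _ _))// ler_wpM2l//.
    have ct : c t - w0 = t *: e by rewrite /c addrC addKr.
    have nt : norm2 (c t - w0) <= norm2 e.
      by rewrite ct norm2Z ger0_norm ?(ltW t0)// ler_piMl ?norm2_ge0.
    apply: le_trans (hL _ (le_lt_trans nt ur) e) _.
    by rewrite expr2 mulrA ler_wpM2r ?norm2_ge0// ler_wpM2l.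
  apply: cvg_at_right_filter.
  by have [/derivable1_diffP ? _] := gd 0; exact: differentiable_continuous.
have [->|z0] := eqVneq z 0.
  by rewrite normr0 mulr_ge0// exprn_ge0// norm2_ge0.
have zz : `|z| * `|z| <= `|z| * (L * norm2 e ^+ 2).
  rewrite -expr2 sqr_norm_inner {2}/z !linearBr -/e.
  have c1 : c 1 = u by rewrite /c /e scale1r addrC subrK.
  have c0 : c 0 = w0 by rewrite /c scale0r addr0.
  by move: g10; rewrite /g c1 c0 /k; lra.
by rewrite -(ler_pM2l (x := `|z|)) ?normr_gt0.
Qed.

End model.

(** * Comparison of the two gradient fields *)

Section comparison.
Context {R : realType} {p : nat} {F : hilbertType R}.
Context (h : 'rV[R]_p -> F) (obj : F -> R) (w0 : 'rV[R]_p).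
Context (h_diff : forall u, differentiable h u).
Context (obj_diff : forall x, differentiable obj x).
Context (h_w0 : h w0 = 0).

Context (r L K l : R) (L0 : 0 <= L) (K0 : 0 <= K) (l0 : 0 <= l).
Context (Dh_lip : forall u, norm2 (u - w0) < r ->
  forall v, `|'d h u v - 'd h w0 v| <= L * norm2 (u - w0) * norm2 v).
Context (Dh_le : forall v, `|'d h w0 v| <= K * norm2 v).

Let G := grad (@inner R F) obj.
Context (G_lip : forall x y, `|G x - G y| <= l * `|x - y|).

Context (C a : R) (u : 'rV[R]_p) (C0 : 0 <= C) (a1 : 1 <= a).
Context (ur : norm2 (u - w0) < r) (uC : norm2 (u - w0) <= C / a).

Let a0 : 0 < a. Proof. exact: lt_le_trans ltr01 a1. Qed.

(** The gap splits into a second-order Taylor remainder at u, multiplied by a,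
    and the linear model applied to u - v. *)
Lemma model_gap_le v :
  `|a *: h u - a *: linearized h w0 v| <=
    L * C ^+ 2 / a + a * K * norm2 (u - v).
Proof.
have -> : a *: h u - a *: linearized h w0 v =
    a *: (h u - h w0 - 'd h w0 (u - w0)) + a *: 'd h w0 (u - v).
  rewrite -scalerBr -scalerDr; congr (_ *: _).
  have -> : 'd h w0 (u - v) = 'd h w0 (u - w0) - 'd h w0 (v - w0).
    by rewrite -linearB opprB addrA subrK.
  by rewrite /linearized opprD !addrA subrK.
rewrite (le_trans (ler_normD _ _))// !normrZ gtr0_norm// lerD//; last first.
  by rewrite -mulrA ler_wpM2l ?(ltW a0)// Dh_le.
have taylor := taylor1_le h_diff L0 Dh_lip ur.
have sq : norm2 (u - w0) ^+ 2 <= (C / a) ^+ 2.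
  by rewrite ler_pXn2r// nnegrE ?norm2_ge0// divr_ge0 ?(ltW a0).
have -> : L * C ^+ 2 / a = a * (L * (C / a) ^+ 2) by field; rewrite gt_eqF.
by rewrite ler_wpM2l ?(ltW a0)// (le_trans taylor)// ler_wpM2l.
Qed.

Let N := `|G 0| + l * (L * C ^+ 2 + K * C).

(** The scaled model output stays bounded as a grows, because u moves by
    O(1 / a); this is where the initialization h w0 = 0 enters. *)
Lemma norm_grad_le : `|G (a *: h u)| <= N.
Proof.
have := model_gap_le w0.
rewrite /linearized subrr linear0 addr0 h_w0 scaler0 subr0 => gap.
have y_le : `|a *: h u| <= L * C ^+ 2 + K * C.
  rewrite (le_trans gap)// lerD//.
    by rewrite ler_pdivrMr// ler_peMr// mulr_ge0// sqr_ge0.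
  have -> : a * K * norm2 (u - w0) = K * (norm2 (u - w0) * a) by ring.
  by rewrite ler_wpM2l// -ler_pdivlMr.
rewrite -[G _](subrK (G 0)) (le_trans (ler_normD _ _))// addrC lerD2l.
by rewrite (le_trans (G_lip _ _))// subr0 ler_wpM2l.
Qed.

Let A := l * K * L * C ^+ 2 + N * L * C.

(** The right-hand side of the differential inequality satisfied by the squared
    distance between the two flows at the positions u and v. The difference of
    the two gradients tested against u - v has two parts: the gap between the
    outputs, controlled by model_gap_le and the Lipschitz constant l, and the
    drift of the differential of h away from w0, of size L * C / a, against the
    bounded gradient N. Together they give
    2 * (A / a ^+ 2) * n + 2 * l * K ^+ 2 * n ^+ 2 for n = norm2 (u - v), and
    the cross term is absorbed by completing the square. *)
Lemma flow_gap_rate_le v :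
  2 * ('d (scaled_objective obj (linearized h w0) a) v (u - v) -
       'd (scaled_objective obj h a) u (u - v)) <=
  (A / a ^+ 2) ^+ 2 + (1 + 2 * l * K ^+ 2) * norm2 (u - v) ^+ 2.
Proof.
have lin := is_diff_linearized v (h_diff w0).
have an0 : a != 0 by rewrite gt_eqF.
have E1 := diff_scaled_objective (u - v) an0 obj_diff (h_diff u).
have E2 : 'd (scaled_objective obj (linearized h w0) a) v (u - v) =
    a^-1 * inner (G (a *: linearized h w0 v)) ('d h w0 (u - v)).
  have [lin_diff lin_val] := lin.
  have E := congr1 (@^~ (u - v)) lin_val.
  apply: etrans (diff_scaled_objective (u - v) an0 obj_diff lin_diff) _.
  exact: (congr1 (fun z => a^-1 * inner (G (a *: linearized h w0 v)) z) E).
rewrite [leLHS](congr2 (fun x y => 2 * (x - y)) E2 E1) -mulrBr mulrA.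
have split (g g' D D' : F) :
    inner g' D - inner g D' = inner (g' - g) D + inner g (D - D').
  by rewrite linearBl linearBr /= addrA subrK.
rewrite split.
pose y := a *: h u; pose y' := a *: linearized h w0 v.
have n0 : 0 <= norm2 (u - v) by exact: norm2_ge0.
have d1 : inner (G y' - G y) ('d h w0 (u - v)) <=
    l * (L * C ^+ 2 / a + a * K * norm2 (u - v)) * (K * norm2 (u - v)).
  apply: le_trans (inner_le _ _) _; apply: ler_pM => //.
  by rewrite (le_trans (G_lip _ _))// ler_wpM2l// distrC; exact: model_gap_le.
have d2 : inner (G y) ('d h w0 (u - v) - 'd h u (u - v)) <=
    N * (L * (C / a) * norm2 (u - v)).
  apply: le_trans (inner_le _ _) _; apply: ler_pM => //.
    exact: norm_grad_le.
  by rewrite distrC (le_trans (Dh_lip ur _))// ler_wpM2r// ler_wpM2l.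
have ai : 0 <= 2 * a^-1 by rewrite mulr_ge0// invr_ge0 ltW.
apply: le_trans (ler_wpM2l ai (lerD d1 d2)) _.
have -> : 2 * a^-1 * (l * (L * C ^+ 2 / a + a * K * norm2 (u - v)) *
      (K * norm2 (u - v)) + N * (L * (C / a) * norm2 (u - v))) =
    2 * (A / a ^+ 2) * norm2 (u - v) + 2 * l * K ^+ 2 * norm2 (u - v) ^+ 2.
  by rewrite /A; field.
move: (A / a ^+ 2) (norm2 (u - v)) => x n.
by rewrite -subr_ge0 [leRHS](_ : _ = (x - n) ^+ 2) ?sqr_ge0//; ring.
Qed.

End comparison.

(** * The lazy regime on a fixed time horizon *)

(** A pointwise bound that is uniform on [0, T] passes to sup_on; it also
    guarantees that the supremum is not the dummy value of an unbounded set. *)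
Lemma sup_on_eqO (R : realType) (f : R -> R -> R) (g : R -> R) (T k a0 : R) :
  0 <= T -> 0 <= k ->
  (forall a t, a0 <= a -> 0 <= t <= T -> 0 <= f a t <= k * `|g a|) ->
  (fun a => sup_on T (f a)) =O_+oo g.
Proof.
move=> T0 k0 fle.
(* The constant of a big O must be positive, while k may be 0. *)
apply/eqO_exP; exists (k + 1); first by rewrite ltr_wpDl.
apply: (@filterS _ +oo _ _ _ _ (nbhs_pinfty_ge (num_real a0))) => a aa0.
have fT0 : [set f a t | t in `[0, T]] (f a 0).
  by exists 0 => //=; rewrite in_itv /= lexx.
have ub : ubound [set f a t | t in `[0, T]] (k * `|g a|).
  by move=> _ [t /= + <-]; rewrite in_itv /= => /(fle a t aa0)/andP[].
rewrite ger0_norm.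
  rewrite (le_trans (ge_sup _ ub))//; first by exists (f a 0).
  by rewrite ler_wpM2r// lerDl.
have T00 : 0 <= (0 : R) <= T by rewrite lexx.
have /andP[f00 _] := fle a 0 aa0 T00.
by rewrite (le_trans f00)//; apply: ub_le_sup fT0; exists (k * `|g a|).
Qed.

Theorem theorem2p2 (R : realType) (p : nat) (F : hilbertType R)
    (h : 'rV[R]_p -> F) (obj : F -> R) (w0 : 'rV[R]_p)
    (w wbar : R -> R -> 'rV[R]_p)
    (h_diff : forall u : 'rV[R]_p, differentiable h u)
    (h_lip : locally_lipschitz_diff h)
    (obj_ge0 : forall x : F, 0 <= obj x)
    (obj_diff : forall x : F, differentiable obj x)
    (obj_lip : lipschitz (grad (@inner R F) obj))
    (h_w0 : h w0 = 0)
    (w_flow : forall a : R, 0 < a ->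
      gradient_flow (scaled_objective obj h a) w0 (w a))
    (wbar_flow : forall a : R, 0 < a ->
      gradient_flow (scaled_objective obj (linearized h w0) a) w0 (wbar a)) :
  forall T : R, 0 < T ->
    [/\ (fun a : R => sup_on T (fun t => norm2 (w a t - w0)))
          =O_+oo (fun a => a^-1),
        (fun a : R => sup_on T (fun t => norm2 (w a t - wbar a t)))
          =O_+oo (fun a => (a ^+ 2)^-1) &
        (fun a : R => sup_on T (fun t =>
            `|a *: h (w a t) - a *: linearized h w0 (wbar a t)|))
          =O_+oo (fun a => a^-1)].
Proof.
move=> T T0; have T0' := ltW T0.
pose G := grad (@inner R F) obj.
have [l l0 G_lip] :
    exists2 l, 0 <= l & forall x y, `|G x - G y| <= l * `|x - y|.
  have [l /ltW l0 lP] := pinfty_ex_gt0 obj_lip.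
  by exists l => // x y; exact: (lP (x, y) (conj I I)).
have [r r0 [L L0 Dh_lip]] := locally_lipschitz_diff_center w0 h_diff h_lip.
have [K /ltW K0 Dh_le] := linear_norm2_lipschitz (diff_continuous (h_diff w0)).
pose C := Num.sqrt (T * obj 0); have C0 : 0 <= C by exact: sqrtr_ge0.
pose N := `|G 0| + l * (L * C ^+ 2 + K * C).
pose A := l * K * L * C ^+ 2 + N * L * C.
have A0 : 0 <= A by rewrite /A /N ?(addr_ge0, mulr_ge0, exprn_ge0).
pose B := 1 + 2 * l * K ^+ 2.
have B0 : 0 <= B by rewrite /B ?(addr_ge0, mulr_ge0, exprn_ge0).
pose E := Num.sqrt (T * expR (B * T)); have E0 : 0 <= E by exact: sqrtr_ge0.
(* From a0 on, the displacement C / a is below the radius r on which the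
   differential of h is Lipschitz around w0. *)
pose a0 := 1 + C / r.
have a0_ge1 a : a0 <= a -> 1 <= a.
  by apply: le_trans; rewrite lerDl divr_ge0// ltW.
have a_gt0 a : a0 <= a -> 0 < a by move=> /a0_ge1; exact: lt_le_trans.
have dist a t : a0 <= a -> 0 <= t <= T -> norm2 (w a t - w0) <= C / a.
  move=> /a_gt0 a0' /andP[t0 tT].
  rewrite -(ler_pXn2r (n := 2)) ?nnegrE ?norm2_ge0 ?divr_ge0 ?(ltW a0')//.
  have Fd u : differentiable (scaled_objective obj h a) u.
    exact: differentiable_scaled_objective.
  have F0 u : 0 <= scaled_objective obj h a u.
    by rewrite mulr_ge0// invr_ge0 sqr_ge0.
  rewrite (le_trans (gradient_flow_dist Fd F0 (w_flow _ a0') t0))//.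
  rewrite /scaled_objective h_w0 scaler0 expr_div_n sqr_sqrtr ?mulr_ge0//.
  by rewrite mulrCA [leRHS]mulrC ler_wpM2l ?invr_ge0 ?sqr_ge0// ler_wpM2r.
have near_w0 a t : a0 <= a -> 0 <= t <= T -> norm2 (w a t - w0) < r.
  move=> aa0 tT; apply: le_lt_trans (dist a t aa0 tT) _.
  rewrite ltr_pdivrMr ?a_gt0// -ltr_pdivrMl// mulrC.
  by apply: lt_le_trans aa0; rewrite ltrDr.
have gap a t : a0 <= a -> 0 <= t <= T ->
    norm2 (w a t - wbar a t) <= A * E / a ^+ 2.
  move=> aa0 /andP[t0 tT]; have a0' := a_gt0 _ aa0.
  rewrite -(ler_pXn2r (n := 2)) ?nnegrE ?norm2_ge0//; last first.
    by rewrite divr_ge0 ?sqr_ge0// mulr_ge0.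
  have Aa0 : 0 <= (A / a ^+ 2) ^+ 2 by exact: sqr_ge0.
  apply: le_trans
    (gradient_flow_gronwall (w_flow _ a0') (wbar_flow _ a0') Aa0 B0 t0 _) _.
    move=> s /andP[s0 st].
    have sT : 0 <= s <= T by rewrite (ltW s0) (le_trans st).
    exact: (flow_gap_rate_le h_diff obj_diff h_w0 L0 K0 l0 Dh_lip Dh_le G_lip
      C0 (a0_ge1 _ aa0) (near_w0 _ _ aa0 sT) (dist _ _ aa0 sT)).
  have -> : (A * E / a ^+ 2) ^+ 2 = (A / a ^+ 2) ^+ 2 * (T * expR (B * T)).
    have <- : E ^+ 2 = T * expR (B * T).
      by rewrite sqr_sqrtr ?mulr_ge0 ?expR_ge0.
    by rewrite !exprMn mulrAC.
  by rewrite -mulrA ler_wpM2l// ler_pM ?expR_ge0// ler_expR ler_wpM2l.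
split.
- apply: (@sup_on_eqO R (fun a t => norm2 (w a t - w0)) _ T C a0) => //.
  move=> a t aa0 tT; rewrite norm2_ge0 /=.
  by rewrite ger0_norm ?invr_ge0 ?(ltW (a_gt0 _ aa0))// dist.
- apply: (@sup_on_eqO R (fun a t => norm2 (w a t - wbar a t)) _
    T (A * E) a0) => //; first exact: mulr_ge0.
  move=> a t aa0 tT; rewrite norm2_ge0 /=.
  by rewrite ger0_norm ?invr_ge0 ?sqr_ge0// gap.
- apply: (@sup_on_eqO R (fun a t =>
    `|a *: h (w a t) - a *: linearized h w0 (wbar a t)|) _
    T (L * C ^+ 2 + K * (A * E)) a0) => //.
    by rewrite addr_ge0 ?mulr_ge0 ?sqr_ge0.
  move=> a t aa0 tT; rewrite normr_ge0 /=; have a0' := a_gt0 _ aa0.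
  rewrite ger0_norm ?invr_ge0 ?(ltW a0')// mulrDl.
  have := model_gap_le h_diff L0 Dh_lip Dh_le C0 (a0_ge1 _ aa0)
    (near_w0 _ _ aa0 tT) (dist _ _ aa0 tT) (wbar a t).
  move=> /le_trans; apply; rewrite lerD2l.
  have -> : K * (A * E) / a = a * K * (A * E / a ^+ 2).
    by field; rewrite gt_eqF.
  by rewrite ler_wpM2l ?gap// mulr_ge0// ltW.
Qed.
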